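(* Let $\mathcal{M}=\langle S,N,V\rangle$ be a neighborhood model. For each $w\in S$ let $S_w=\{X\subseteq S\mid w\notin X\}$ and let $\Gamma_w\subseteq S_w$ be an arbitrary subset. Define $\mathcal{M}^{t^+}=\langle S,N^{t^+},V\rangle$ and $\mathcal{M}^{t^-}=\langle S,N^{t^-},V\rangle$, where for each $w\in S$, $N^{t^+}(w)=N(w)\cup\Gamma_w$ and $N^{t^-}(w)=N(w)\setminus\Gamma_w$. Then for each $w\in S$ and each $\alpha\in\mathcal{L}(\bullet)$, $$\mathcal{M},w\vDash\alpha\ \text{ iff }\ \mathcal{M}^{t^+},w\vDash\alpha$$ and $$\mathcal{M},w\vDash\alpha\ \text{ iff }\ \mathcal{M}^{t^-},w\vDash\alpha.$$
   Context: Fix a nonempty set $\mathbf{P}$ of propositional variables, $p\in\mathbf{P}$. $\mathcal{L}(\bullet)$: $\varphi::=p\mid\neg\varphi\mid\varphi\land\varphi\mid\bullet\varphi$. A neighborhood model is $\mathcal{M}=\langle S,N,V\rangle$ with $S$ a nonempty set, $N:S\to\mathcal{P}(\mathcal{P}(S))$, and $V:\mathbf{P}\to\mathcal{P}(S)$. With $\varphi^{\mathcal{M}}=\{s\in S\mid\mathcal{M},s\vDash\varphi\}$: $\mathcal{M},s\vDash p$ iff $s\in V(p)$; Boolean connectives as usual; $\mathcal{M},s\vDash\bullet\varphi$ iff $s\in\varphi^{\mathcal{M}}$ and $\varphi^{\mathcal{M}}\notin N(s)$. *)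

(* Defs.v *)
From mathcomp Require Import all_boot.
From mathcomp Require Import classical_sets.

Set Implicit Arguments.
Unset Strict Implicit.
Unset Printing Implicit Defensive.

Local Open Scope classical_set_scope.

Inductive formula (P : Type) : Type :=
| Var of P
| Neg of formula P
| And of formula P & formula P
| Bullet of formula P.

Record model (P : Type) : Type := Model {
  state :> Type;
  state_nonempty : inhabited state;
  nbh : state -> set (set state);
  valuation : P -> set state
}.

Fixpoint sat (P : Type) (M : model P) (s : M) (phi : formula P) : Prop :=
  match phi with
  | Var p => @valuation P M p s
  | Neg psi => ~ sat s psi
  | And psi chi => sat s psi /\ sat s chi
  | Bullet psi =>
      let truth_set := [set t : M | sat t psi] in
      truth_set s /\ ~ nbh s truth_set
  end.

Definition sets_avoiding (S : Type) (w : S) : set (set S) := [set X | ~ X w].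

Definition model_plus (P : Type) (M : model P) (Gamma : M -> set (set M)) :
    model P :=
  Model (state_nonempty M) (fun w => nbh w `|` Gamma w) (@valuation P M).

Definition model_minus (P : Type) (M : model P) (Gamma : M -> set (set M)) :
    model P :=
  Model (state_nonempty M) (fun w => nbh w `\` Gamma w) (@valuation P M).

(* Main.v *)
(** The [Bullet] clause at [w] consults [N w] only on truth sets that contain
    [w], so altering [N w] on sets avoiding [w] changes no truth value. *)
Require Import Defs.
From mathcomp Require Import all_boot.
From mathcomp Require Import classical_sets.

Local Open Scope classical_set_scope.

(** Adding and removing [Gamma] are two cases of one invariance: by induction on formulas,
    satisfaction depends on [nbh w] only through its members containing [w]. *)

Lemma sat_nbh_ext (P : Type) (M : model P) (N : M -> set (set M)) :
  (forall (w : M) (X : set M), X w -> nbh w X <-> N w X) ->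
  forall (alpha : formula P) (w : M),
    @sat P M w alpha <->
    @sat P (Model (state_nonempty M) N (@valuation P M)) w alpha.
Proof.
move=> NE; elim=> [p|phi IH|phi IHphi psi IHpsi|phi IH] w //=.
- by split=> nphi /IH.
- by split=> -[/IHphi ? /IHpsi ?].
(* [IH] holds at every state, so both models test the same truth set; when it contains [w], [NE]
   applies to it. *)
- have -> : [set t | @sat P (Model (state_nonempty M) N (@valuation P M)) t phi]
          = [set t : M | sat t phi] by apply/seteqP; split=> t /IH.
  split=> -[/IH phiw nNw]; split=> //.
  + by move=> /NE-/(_ (proj2 (IH w) phiw)).
  + by move=> /NE-/(_ phiw).
Qed.

Theorem proposition4p3 (P : Type) (P_nonempty : inhabited P) (M : model P)
    (Gamma : M -> set (set M))
    (Gamma_sub : forall w : M, Gamma w `<=` sets_avoiding w) :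
  forall (w : M) (alpha : formula P),
    (@sat P M w alpha <-> @sat P (model_plus Gamma) w alpha) /\
    (@sat P M w alpha <-> @sat P (model_minus Gamma) w alpha).
Proof.
(* A set [X] containing [w] is never in [Gamma w], so neither union nor difference affects its
   membership. *)
move=> w alpha; split; apply: sat_nbh_ext => {w alpha} w X Xw; split.
- by left.
- by case=> // /Gamma_sub /(_ Xw).
- by move=> NX; split=> // /Gamma_sub /(_ Xw).
- by case.
Qed.
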